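(* Let $X,Y\subset\mathbb R^d$ be closed, $\Omega=X\times Y$, let $\mu$ and $\nu$ be Borel probability measures on $X$ and $Y$, and let $f_1,\dots,f_N\in\mathcal C_b=C_b(\Omega)$. Suppose that for each $k=1,\dots,N$, $$\inf_{\eta\in\mathcal Q_{k-1}}\eta(f_k)<0<\sup_{\eta\in\mathcal Q_{k-1}}\eta(f_k).$$ Then $$\mathfrak H_{cot}=\mathfrak H_{ot}+\sum_{i=1}^N\mathfrak F_i,\qquad \mathfrak K_{cot}=\mathfrak H_{cot}+(\mathcal C_b'')_- .$$ In particular, for every $\mathfrak a\in\mathcal C_b''$, $$\begin{aligned}\sup_{\eta\in\mathcal Q_{cot}}\mathfrak a(\eta)&=\mathbf D(\mathfrak a;\mathfrak H_{cot}+(\mathcal C_b'')_-)\\&=\min\Big\{c\in\mathbb R:\ \exists\,\mathfrak h\in C_b(X)'',\ \mathfrak g\in C_b(Y)'',\ a_1,\dots,a_N\in\mathbb R\text{ with }\mathfrak h(\mu)=\mathfrak g(\nu)=0\\&\hspace{60pt}\text{and}\quad c\,\mathfrak I(\mathbf 1)+\mathfrak h\oplus\mathfrak g+\sum_{k=1}^N a_k\,\mathfrak I(f_k)\ge\mathfrak a\Big\}.\end{aligned}$$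
   Context: $C_b(\cdot)$ denotes bounded continuous real functions with the supremum norm; $\mathbf 1$ is the constant function $1$. Primes denote topological duals, ordered by duality; $(\cdot)_\pm$ denotes positive/negative elements; $\mathfrak I:\mathcal C_b\to\mathcal C_b''$ is the canonical embedding; $\perp$ denotes the annihilator in the dual. $(h\oplus g)(x,y)=h(x)+g(y)$. For $\eta\in\mathcal C_b'$: $\eta_x(h)=\eta(h\oplus\mathbf 0)$, $\eta_y(g)=\eta(\mathbf 0\oplus g)$; for $\mathfrak h\in C_b(X)''$, $\mathfrak g\in C_b(Y)''$: $(\mathfrak h\oplus\mathfrak g)(\eta)=\mathfrak h(\eta_x)+\mathfrak g(\eta_y)$. Measures are identified with the functionals given by integration. $\partial B'_+=\{\eta\in(\mathcal C_b')_+:\eta(\mathbf 1)=1\}$. $\mathcal H_{ot}=\{h\oplus g:h\in C_b(X),\ g\in C_b(Y),\ \mu(h)=\nu(g)=0\}$, $\mathcal H_0=\mathcal H_{ot}$, $\mathcal Q_0=\mathcal Q_{ot}=\mathcal H_{ot}^\perp\cap\partial B'_+$. For $k=1,\dots,N$: $$\mathcal H_k=\Big\{f+\sum_{i=1}^k a_if_i: f\in\mathcal H_{ot},\ a_i\in\mathbb R\Big\},\qquad \mathcal Q_k=\mathcal H_k^\perp\cap\partial B'_+ .$$ $\mathcal Q_{cot}=\mathcal Q_N$, $\mathcal H_{cot}=\mathcal H_N$, $\mathfrak H_{ot}=(\mathcal H_{ot}^\perp)^\perp$, $\mathfrak H_{cot}=(\mathcal H_{cot}^\perp)^\perp$ (subsets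 of $\mathcal C_b''$), $\mathfrak K_{cot}=\{\mathfrak z\in\mathcal C_b'':\mathfrak z(\eta)\le0\ \forall\eta\in\mathcal Q_{cot}\}$, and $\mathfrak F_k$ is the linear span of $\mathfrak I(f_k)$. $\mathbf D(\mathfrak a;\mathfrak K)=\inf\{c\in\mathbb R:\exists\,\mathfrak z\in\mathfrak K\text{ with }c\,\mathfrak I(\mathbf 1)+\mathfrak z=\mathfrak a\}$. *)

(* Defs.v *)
From HB Require Import structures.
From mathcomp Require Import all_boot all_order all_algebra.
From mathcomp Require Import all_classical all_reals all_analysis.
From mathcomp Require Import measurable_realfun.

Set Implicit Arguments.
Unset Strict Implicit.
Unset Printing Implicit Defensive.

Import Order.TTheory GRing.Theory Num.Theory.
Import numFieldNormedType.Exports.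

Local Open Scope classical_set_scope.
Local Open Scope ring_scope.

Section SupNorm.
Context (R : realType) (I : Type).
Implicit Types (D : set I) (g : I -> R) (M : R).

Lemma supnorm_ub D g M i : (forall j, D j -> `|g j| <= M) -> D i ->
  `|g i| <= sup [set `|g j| | j in D].
Proof.
move=> gM Di; apply: ub_le_sup; last by exists i.
by exists M => _ [j Dj <-]; exact: gM.
Qed.

Lemma supnorm_le D g M : 0 <= M -> (forall j, D j -> `|g j| <= M) ->
  sup [set `|g j| | j in D] <= M.
Proof.
move=> M0 gM; have [S0|/set0P S0] := eqVneq [set `|g j| | j in D] set0.
  by rewrite S0 sup0.
by apply: ge_sup => // _ [j Dj <-]; exact: gM.
Qed.

Lemma supnorm_ge0 D g M : (forall j, D j -> `|g j| <= M) ->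
  0 <= sup [set `|g j| | j in D].
Proof.
move=> gM; have [S0|/set0P[_ [i Di _]]] := eqVneq [set `|g j| | j in D] set0.
  by rewrite S0 sup0.
by apply: le_trans (supnorm_ub gM Di).
Qed.

End SupNorm.

Section BoundedContinuous.
Context (R : realType) (T : topologicalType).

Definition bcont : {pred T -> R^o} :=
  [pred f | `[< continuous f /\ bounded_fun f >]].

Record bcfun := BCFun { bcfun_val :> T -> R^o ; _ : bcfun_val \in bcont }.

HB.instance Definition _ := [isSub for bcfun_val].
HB.instance Definition _ := [Choice of bcfun by <:].

Lemma bcontP (f : T -> R^o) : reflect
  (continuous f /\ exists M : R, forall x, `|f x| <= M) (f \in bcont).
Proof.
apply: (iffP (asboolP _)) => -[cf bf]; split => //.
  case: bf => M [Mr MB]; exists (M + 1) => x; apply: MB => //.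
  by rewrite ltrDl.
case: bf => M MB; exists M; split; first exact: num_real.
by move=> N MN x _ /=; rewrite (le_trans (MB x))// ltW.
Qed.

Lemma bcont_submod : submod_closed bcont.
Proof.
split.
  apply/bcontP; split; first by move=> x; exact: cvg_cst.
  by exists 0 => x; rewrite normr0.
move=> a f g /bcontP[cf [M fM]] /bcontP[cg [N gN]]; apply/bcontP; split.
  move=> x; apply: cvgD; last exact: cg.
  apply: cvgZr; exact: cf.
exists (`|a| * M + N) => x; rewrite (le_trans (ler_normD _ _))// lerD//.
by rewrite normrM ler_wpM2l.
Qed.

HB.instance Definition _ := GRing.isSubmodClosed.Build _ _ bcont bcont_submod.
HB.instance Definition _ := [SubChoice_isSubLmodule of bcfun by <:].

Lemma bcfunE (a : R) (f g : bcfun) x : (a *: f + g) x = a * f x + g x.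
Proof. by []. Qed.

Lemma bcfun_cont (f : bcfun) : continuous f.
Proof. by case: f => f /= /bcontP[]. Qed.

Lemma bcfun_bnd (f : bcfun) : exists M : R, forall x, `|f x| <= M.
Proof. by case: f => f /= /bcontP[]. Qed.

Definition bcnorm (f : bcfun) : R := sup [set `|f x| | x in [set: T]].

Lemma bcnorm_ub (f : bcfun) x : `|f x| <= bcnorm f.
Proof. by have [M fM] := bcfun_bnd f; apply: (@supnorm_ub _ _ _ _ M). Qed.

Lemma bcnorm_le (f : bcfun) M : 0 <= M -> (forall x, `|f x| <= M) ->
  bcnorm f <= M.
Proof. by move=> M0 fM; apply: supnorm_le. Qed.

Lemma bcnorm_ge0 f : 0 <= bcnorm f.
Proof. by have [M fM] := bcfun_bnd f; apply: (@supnorm_ge0 _ _ _ _ M). Qed.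

Lemma bcnormD f g : bcnorm (f + g) <= bcnorm f + bcnorm g.
Proof.
apply: bcnorm_le => [|x]; first by rewrite addr_ge0 ?bcnorm_ge0.
by rewrite (le_trans (ler_normD _ _))// lerD ?bcnorm_ub.
Qed.

Lemma bcnormZ_le (a : R) f : bcnorm (a *: f) <= `|a| * bcnorm f.
Proof.
apply: bcnorm_le => [|x]; first by rewrite mulr_ge0 ?bcnorm_ge0.
by rewrite normrM ler_wpM2l ?bcnorm_ub.
Qed.

Lemma bcnormZ (a : R) f : bcnorm (a *: f) = `|a| * bcnorm f.
Proof.
apply/eqP; rewrite eq_le bcnormZ_le/=.
have [->|a0] := eqVneq a 0; first by rewrite normr0 mul0r bcnorm_ge0.
rewrite -ler_pdivlMl ?normr_gt0// -normfV.
by apply: le_trans (bcnormZ_le _ _); rewrite scalerA mulVf// scale1r.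
Qed.

Lemma bcnorm0_eq0 f : bcnorm f = 0 -> f = 0.
Proof.
move=> f0; apply: val_inj; apply/funext => x /=; apply/eqP.
by rewrite -normr_le0 -f0 bcnorm_ub.
Qed.

HB.instance Definition _ :=
  Lmodule_isNormed.Build R bcfun bcnormD bcnormZ bcnorm0_eq0.

Lemma bcfun_normE (f : bcfun) : `|f| = sup [set `|f x| | x in [set: T]].
Proof. by []. Qed.

Lemma ler_bcnorm (f : bcfun) x : `|f x| <= `|f|.
Proof. exact: bcnorm_ub. Qed.

Lemma bcnorm_ler (f : bcfun) M : 0 <= M -> (forall x, `|f x| <= M) -> `|f| <= M.
Proof. exact: bcnorm_le. Qed.

End BoundedContinuous.

Section Dual.
Context (R : realType) (V : normedModType R).

Definition cont_linear : {pred V -> R^o} :=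
  [pred f | `[< linear f /\ continuous f >]].

Record tdual := Dual { dual_val :> V -> R^o ; _ : dual_val \in cont_linear }.

HB.instance Definition _ := [isSub for dual_val].
HB.instance Definition _ := [Choice of tdual by <:].

Lemma cont_linearP (f : V -> R^o) : reflect
  (linear f /\ exists M : R, forall v, `|f v| <= M * `|v|) (f \in cont_linear).
Proof.
apply: (iffP (asboolP _)) => -[lf bf]; split => //.
  pose g : {linear V -> R^o} := HB.pack f (GRing.isLinear.Build _ _ _ _ f lf).
  have /linear_bounded_continuous/linear_boundedP : continuous g by [].
  move=> [M [Mr MB]]; exists (M + 1) => v; apply: MB.
  by rewrite ltrDl.
pose g : {linear V -> R^o} := HB.pack f (GRing.isLinear.Build _ _ _ _ f lf).
suff : continuous g by [].
apply/linear_bounded_continuous/linear_boundedP.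
case: bf => M MB; exists M; split; first exact: num_real.
by move=> N MN x; rewrite /= (le_trans (MB x))// ler_wpM2r// ltW.
Qed.

Lemma cont_linear_submod : submod_closed cont_linear.
Proof.
split.
  apply/cont_linearP; split; first by move=> a x y; rewrite /= scaler0 addr0.
  by exists 0 => x; rewrite normr0 mul0r.
move=> a f g /cont_linearP[lf [M fM]] /cont_linearP[lg [N gN]].
apply/cont_linearP; split.
  move=> b x y; rewrite !fctE/= lf lg !scalerDr !scalerA mulrC.
  by rewrite addrACA.
exists (`|a| * M + N) => x; rewrite (le_trans (ler_normD _ _))// mulrDl lerD//.
by rewrite normrM -mulrA ler_wpM2l.
Qed.

HB.instance Definition _ :=
  GRing.isSubmodClosed.Build _ _ cont_linear cont_linear_submod.
HB.instance Definition _ := [SubChoice_isSubLmodule of tdual by <:].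

Lemma dual_linear (f : tdual) : linear f.
Proof. by case: f => f /= /cont_linearP[]. Qed.

HB.instance Definition _ (f : tdual) :=
  GRing.isLinear.Build R V R^o _ f (dual_linear f).

Lemma dual_bnd (f : tdual) : exists M : R, forall v, `|f v| <= M * `|v|.
Proof. by case: f => f /= /cont_linearP[]. Qed.

Lemma dualE (a : R) (f g : tdual) v : (a *: f + g) v = a * f v + g v.
Proof. by []. Qed.

Definition dual_norm (f : tdual) : R := sup [set `|f v| | v in [set v | `|v| <= 1]].

Let dual_bnd1 (f : tdual) : exists M : R, forall v : V, `|v| <= 1 -> `|f v| <= M.
Proof.
have [M fM] := dual_bnd f; exists `|M| => v v1; rewrite (le_trans (fM v))//.
by rewrite -[leRHS]mulr1 (le_trans (ler_norm _))// normrM normr_id ler_wpM2l.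
Qed.

Lemma dual_norm_ge0 f : 0 <= dual_norm f.
Proof. by have [M fM] := dual_bnd1 f; apply: (@supnorm_ge0 _ _ _ _ M). Qed.

Lemma dual_norm_ub (f : tdual) v : `|f v| <= dual_norm f * `|v|.
Proof.
have [->|v0] := eqVneq v 0; first by rewrite linear0 !normr0 mulr0.
have nv0 : 0 < `|v| by rewrite normr_gt0.
have [M fM] := dual_bnd1 f.
rewrite -ler_pdivrMr//.
have -> : `|f v| / `|v| = `|f (`|v|^-1 *: v)|.
  by rewrite linearZ normrM mulrC ger0_norm// invr_ge0.
apply: (@supnorm_ub _ _ _ _ M) => //=.
by rewrite normrZ ger0_norm ?invr_ge0// mulVf// gt_eqF.
Qed.

Lemma dual_norm_le (f : tdual) M : 0 <= M ->
  (forall v, `|v| <= 1 -> `|f v| <= M) -> dual_norm f <= M.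
Proof. by move=> M0 fM; apply: supnorm_le. Qed.

Lemma dual_normD f g : dual_norm (f + g) <= dual_norm f + dual_norm g.
Proof.
apply: dual_norm_le => [|v v1]; first by rewrite addr_ge0 ?dual_norm_ge0.
rewrite (le_trans (ler_normD _ _))// lerD// (le_trans (dual_norm_ub _ _))//.
  by rewrite ler_piMr ?dual_norm_ge0.
by rewrite ler_piMr ?dual_norm_ge0.
Qed.

Lemma dual_normZ_le (a : R) f : dual_norm (a *: f) <= `|a| * dual_norm f.
Proof.
apply: dual_norm_le => [|v v1]; first by rewrite mulr_ge0 ?dual_norm_ge0.
rewrite normrM ler_wpM2l// (le_trans (dual_norm_ub _ _))//.
by rewrite ler_piMr ?dual_norm_ge0.
Qed.

Lemma dual_normZ (a : R) f : dual_norm (a *: f) = `|a| * dual_norm f.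
Proof.
apply/eqP; rewrite eq_le dual_normZ_le/=.
have [->|a0] := eqVneq a 0; first by rewrite normr0 mul0r dual_norm_ge0.
rewrite -ler_pdivlMl ?normr_gt0// -normfV.
by apply: le_trans (dual_normZ_le _ _); rewrite scalerA mulVf// scale1r.
Qed.

Lemma dual_norm0_eq0 f : dual_norm f = 0 -> f = 0.
Proof.
move=> f0; apply: val_inj; apply/funext => v /=; apply/eqP.
by rewrite -normr_le0 (le_trans (dual_norm_ub _ _))// f0 mul0r.
Qed.

HB.instance Definition _ :=
  Lmodule_isNormed.Build R tdual dual_normD dual_normZ dual_norm0_eq0.

Lemma dual_normE (f : tdual) :
  `|f| = sup [set `|f v| | v in [set v : V | `|v| <= 1]].
Proof. by []. Qed.

Lemma ler_dual_norm (f : tdual) v : `|f v| <= `|f| * `|v|.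
Proof. exact: dual_norm_ub. Qed.

Lemma dual_norm_ler (f : tdual) M : 0 <= M ->
  (forall v, `|v| <= 1 -> `|f v| <= M) -> `|f| <= M.
Proof. exact: dual_norm_le. Qed.

End Dual.
Arguments bcfun : clear implicits.

Section Functionals.
Context (R : realType).

Section Cones.
Context (V : normedModType R).

Definition annihilator (A : set V) : set (tdual V) :=
  [set eta | forall v, A v -> eta v = 0].

(* The order on a topological dual, given the positive cone P of V. *)
Definition dual_cone (P : set V) : set (tdual V) :=
  [set eta | forall v, P v -> 0 <= eta v].

(* Minkowski sum. *)
Definition setadd (A B : set V) : set V := [set a + b | a in A & b in B].

Definition line (v : V) : set V := [set a *: v | a in [set: R]].

Lemma bidual_emb_subproof (v : V) :
  (fun eta : tdual V => eta v : R^o) \in @cont_linear R (tdual V).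
Proof.
apply/cont_linearP; split => //; exists `|v| => eta.
by rewrite mulrC ler_dual_norm.
Qed.

Definition bidual_emb (v : V) : tdual (tdual V) := Dual (bidual_emb_subproof v).

End Cones.

Section PositiveElements.
Context (T : topologicalType).

Definition bc_pos : set (bcfun R T) := [set f | forall x, 0 <= f x].
Definition dual_pos : set (tdual (bcfun R T)) := dual_cone bc_pos.
Definition bidual_pos : set (tdual (tdual (bcfun R T))) := dual_cone dual_pos.
Definition bidual_neg : set (tdual (tdual (bcfun R T))) :=
  [set z | bidual_pos (- z)].
Definition bidual_le (z w : tdual (tdual (bcfun R T))) : Prop :=
  bidual_pos (w - z).

Lemma bc_one_subproof : (fun=> 1 : R^o) \in @bcont R T.
Proof.
apply/bcontP; split; first by move=> x; exact: cvg_cst.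
by exists 1 => x; rewrite normr1.
Qed.

Definition bc_one : bcfun R T := BCFun bc_one_subproof.

Definition states : set (tdual (bcfun R T)) :=
  [set eta | dual_pos eta /\ eta bc_one = 1].

(* The value is +oo when no c is feasible. *)
Definition Dval (a : tdual (tdual (bcfun R T)))
    (K : set (tdual (tdual (bcfun R T)))) : \bar R :=
  ereal_inf [set c%:E | c in
    [set c : R | exists2 z, K z & c *: bidual_emb bc_one + z = a]].

End PositiveElements.

Section Integration.
Context (T : topologicalType).

(* Measurable types are pointed in this library, whereas a subset of R^d, seen
   as a type, carries no canonical point: hence the base point t0, which plays
   no other role. A type bearing a probability measure is inhabited. *)
Definition based (t0 : T) : Type := T.
HB.instance Definition _ (t0 : T) := gen_eqMixin (based t0).
HB.instance Definition _ (t0 : T) := gen_choiceMixin (based t0).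
HB.instance Definition _ (t0 : T) := isPointed.Build (based t0) t0.

Definition borel (t0 : T) :=
  g_sigma_algebraType (@open T : set (set (based t0))).

Context (t0 : T) (mu : probability (borel t0) R).

Lemma bcfun_measurable (f : bcfun R T) :
  measurable_fun [set: borel t0] (f : borel t0 -> R).
Proof.
apply: (measurability _ (RGenOpens.measurableE R)) => _ [_ [a [b ->]] <-].
rewrite setTI; apply: sub_sigma_algebra.
by apply: open_comp => [x _|]; [exact: bcfun_cont|exact: interval_open].
Qed.

Lemma bcfun_integrable (f : bcfun R T) :
  mu.-integrable [set: borel t0] (EFin \o (f : borel t0 -> R)).
Proof.
apply: measurable_bounded_integrable => //.
- by rewrite (le_lt_trans (probability_le1 _ _))// ltry.
- exact: bcfun_measurable.
- have [M fM] := bcfun_bnd f; exists M; split; first exact: num_real.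
  by move=> N MN x _ /=; rewrite (le_trans (fM x))// ltW.
Qed.

Lemma integral_dual_subproof :
  (fun h : bcfun R T => \int[mu]_x h x : R^o) \in @cont_linear R (bcfun R T).
Proof.
apply/cont_linearP; split.
  move=> a f g.
  have -> : \int[mu]_x (a *: f + g) x = \int[mu]_x (a * f x + g x) by [].
  have ia : mu.-integrable [set: borel t0] (EFin \o (fun x => a * f x)).
    exact: (bcfun_integrable (a *: f)).
  rewrite (RintegralD _ _ (bcfun_integrable g))//.
  by rewrite RintegralZl//; exact: bcfun_integrable.
exists 1 => f; rewrite mul1r.
rewrite (le_trans (le_normr_Rintegral _ (bcfun_integrable f)))//.
have ic : mu.-integrable [set: borel t0] (EFin \o (fun=> `|f|)).
  exact: (finite_measure_integrable_cst mu `|f|).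
rewrite (@le_trans _ _ (\int[mu]_(x in [set: borel t0]) `|f|))//.
  apply: le_Rintegral => //; last by move=> x _; exact: ler_bcnorm.
  by have /integrable_norm := bcfun_integrable f.
rewrite Rintegral_cst//; have := probability_setT mu.
by rewrite /= => ->; rewrite mulr1.
Qed.

Definition integral_dual : tdual (bcfun R T) := Dual integral_dual_subproof.

End Integration.

Section DirectSum.
Context (X Y : topologicalType).

Lemma oplus_subproof (h : bcfun R X) (g : bcfun R Y) :
  (fun p : X * Y => h p.1 + g p.2 : R^o) \in @bcont R (X * Y)%type.
Proof.
have [[M hM] [N gN]] := (bcfun_bnd h, bcfun_bnd g).
apply/bcontP; split.
  move=> p; apply: cvgD.
    by apply: continuous_comp; [exact: cvg_fst|exact: bcfun_cont].
  by apply: continuous_comp; [exact: cvg_snd|exact: bcfun_cont].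
by exists (M + N) => p; rewrite (le_trans (ler_normD _ _))// lerD.
Qed.

Definition oplus (h : bcfun R X) (g : bcfun R Y) : bcfun R (X * Y)%type :=
  BCFun (oplus_subproof h g).

Lemma oplus_linear (a : R) h h' g g' :
  oplus (a *: h + h') (a *: g + g') = a *: oplus h g + oplus h' g'.
Proof.
apply: val_inj; apply/funext => p; rewrite -[LHS]/(a * h p.1 + h' p.1 +
  (a * g p.2 + g' p.2)) -[RHS]/(a * (h p.1 + g p.2) + (h' p.1 + g' p.2)).
by rewrite mulrDr addrACA.
Qed.

Lemma marginal1_subproof (eta : tdual (bcfun R (X * Y)%type)) :
  (fun h => eta (oplus h 0)) \in @cont_linear R (bcfun R X).
Proof.
apply/cont_linearP; split.
  move=> a h h'; have := oplus_linear a h h' 0 0.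
  by rewrite scaler0 addr0 => ->; rewrite linearP.
exists `|eta| => h; rewrite (le_trans (ler_dual_norm _ _))//.
rewrite ler_wpM2l//; apply: bcnorm_ler => // p /=.
by rewrite addr0 ler_bcnorm.
Qed.

Definition marginal1 (eta : tdual (bcfun R (X * Y)%type)) : tdual (bcfun R X) :=
  Dual (marginal1_subproof eta).

Lemma marginal2_subproof (eta : tdual (bcfun R (X * Y)%type)) :
  (fun g => eta (oplus 0 g)) \in @cont_linear R (bcfun R Y).
Proof.
apply/cont_linearP; split.
  move=> a g g'; have := oplus_linear a 0 0 g g'.
  by rewrite scaler0 addr0 => ->; rewrite linearP.
exists `|eta| => g; rewrite (le_trans (ler_dual_norm _ _))//.
rewrite ler_wpM2l//; apply: bcnorm_ler => // p /=.
by rewrite add0r ler_bcnorm.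
Qed.

Definition marginal2 (eta : tdual (bcfun R (X * Y)%type)) : tdual (bcfun R Y) :=
  Dual (marginal2_subproof eta).

Lemma marginal1_linear (a : R) eta eta' :
  marginal1 (a *: eta + eta') = a *: marginal1 eta + marginal1 eta'.
Proof. exact: val_inj. Qed.

Lemma marginal2_linear (a : R) eta eta' :
  marginal2 (a *: eta + eta') = a *: marginal2 eta + marginal2 eta'.
Proof. exact: val_inj. Qed.

Lemma marginal1_norm eta : `|marginal1 eta| <= `|eta|.
Proof.
apply: dual_norm_ler => // h h1; apply: (le_trans (ler_dual_norm eta (oplus h 0))).
rewrite ler_piMr//; apply: bcnorm_ler => // p /=.
by rewrite addr0 (le_trans (ler_bcnorm _ _)).
Qed.

Lemma marginal2_norm eta : `|marginal2 eta| <= `|eta|.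
Proof.
apply: dual_norm_ler => // g g1; apply: (le_trans (ler_dual_norm eta (oplus 0 g))).
rewrite ler_piMr//; apply: bcnorm_ler => // p /=.
by rewrite add0r (le_trans (ler_bcnorm _ _)).
Qed.

Lemma bioplus_subproof (h : tdual (tdual (bcfun R X)))
    (g : tdual (tdual (bcfun R Y))) :
  (fun eta => h (marginal1 eta) + g (marginal2 eta))
    \in @cont_linear R (tdual (bcfun R (X * Y)%type)).
Proof.
apply/cont_linearP; split.
  move=> a eta eta'; rewrite marginal1_linear marginal2_linear !linearP.
  by rewrite scalerDr addrACA.
exists (`|h| + `|g|) => eta; rewrite (le_trans (ler_normD _ _))// mulrDl lerD//.
  by rewrite (le_trans (ler_dual_norm _ _))// ler_wpM2l// marginal1_norm.
by rewrite (le_trans (ler_dual_norm _ _))// ler_wpM2l// marginal2_norm.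
Qed.

Definition bioplus (h : tdual (tdual (bcfun R X))) (g : tdual (tdual (bcfun R Y))) :
  tdual (tdual (bcfun R (X * Y)%type)) := Dual (bioplus_subproof h g).

End DirectSum.

Section ConstrainedTransport.
Context (X Y : topologicalType) (x0 : X) (y0 : Y).
Context (mu : probability (borel x0) R) (nu : probability (borel y0) R).
Local Notation Cb := (bcfun R (X * Y)%type).
Context (N : nat) (f : 'I_N -> Cb).

Definition Hot : set Cb :=
  [set w | exists h g, [/\ integral_dual mu h = 0, integral_dual nu g = 0 &
                           w = oplus h g]].

(* The constraint f_k is [f i] with i = k - 1, so that the sum runs over
   f_1, ..., f_k. *)
Definition Hk (k : nat) : set Cb :=
  [set w | exists h, exists a : 'I_N -> R,
     Hot h /\ w = h + \sum_(i < N | (i < k)%N) a i *: f i].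

Definition Qk (k : nat) : set (tdual Cb) :=
  annihilator (Hk k) `&` @states (X * Y)%type.

Definition Qcot := Qk N.
(* The annihilators are taken in the dual, then in the bidual. *)
Definition bidual_Hot : set (tdual (tdual Cb)) := annihilator (annihilator Hot).
Definition bidual_Hcot : set (tdual (tdual Cb)) :=
  annihilator (annihilator (Hk N)).
Definition Kcot : set (tdual (tdual Cb)) :=
  [set z | forall eta, Qcot eta -> z eta <= 0].

End ConstrainedTransport.

End Functionals.

(* Main.v *)
Require Import Defs.
From HB Require Import structures.
From mathcomp Require Import all_boot all_order all_algebra.
From mathcomp Require Import all_classical all_reals all_analysis.
From mathcomp Require Import lra.

Set Implicit Arguments.
Unset Strict Implicit.
Unset Printing Implicit Defensive.

Import Order.TTheory GRing.Theory Num.Theory.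
Import numFieldNormedType.Exports.

Local Open Scope classical_set_scope.
Local Open Scope ring_scope.

(** The inclusions that matter are [Kcot `<=` bidual_Hcot + bidual_neg] and the
    explicit description of [bidual_Hcot]; the rest is bookkeeping.

    For the first, let [z] in the bidual be nonpositive on [Qcot], that is, on
    the positive functionals that annihilate [H = Hk N]. A decomposition
    [z = W + negative] amounts to a continuous linear [W] on the dual with
    [W = 0] on the annihilator of [H] and [W >= z] on the positive cone. By the
    Hahn-Banach theorem ([dominating_dual]) it exists as soon as [z eta] is
    bounded by a multiple of the distance from a positive [eta] to the
    annihilator of [H], and this holds if every positive [eta] is as close, up
    to a constant, to the positive part of that annihilator as it is to the
    whole of it ([dual_error_bound]). This error bound is in turn dual to an
    elementary property of [H] itself, [bounded_domination]: a function [v]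
    dominated by an element of [H] is dominated by an element of norm at most
    [C * |v|].

    Bounded domination holds for [Hot], by balancing and truncating the two
    summands ([Hot_bounded_domination]). It survives the addition of each
    [f k], because the hypothesis on [f k] supplies two elements of [Qk k] that
    give it opposite signs, hence an a priori bound on its coefficient
    ([bounded_domination_line]). The same two elements, convexly combined, show
    that [Qcot] is not empty ([Qcot_nonempty]).

    For the description of [bidual_Hcot], one more constraint cuts the
    annihilator by the kernel of [bidual_emb (f k)], which adds exactly one line
    to the annihilator in the bidual ([annihilator_ker]). Elements of
    [bidual_Hot] split as [bioplus h g] ([bidual_HotP]) because a functional on
    the product agrees, on sums [oplus u v], with a combination of products of
    its marginals with point masses.

    Finally [c] is feasible, for either of the two infima, if and only if
    [a eta <= c] for all [eta] in [Qcot]; so the least feasible [c] is the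
    supremum of [a] over [Qcot], which is finite. *)

(** * Sublinear functionals and the Hahn-Banach theorem *)

Section HahnBanach.
Context (R : realType).

Section Sublinear.
Context (V : lmodType R).
Implicit Types (p q : V -> R) (x y v : V).

Definition sublinear q :=
  (forall x y, q (x + y) <= q x + q y) /\
  (forall (t : R) x, 0 <= t -> q (t *: x) <= t * q x).

Lemma sublinear0 q : sublinear q -> q 0 = 0.
Proof.
move=> [qD qZ]; have := qZ 0 0 (lexx 0); have := qD 0 0.
by rewrite scale0r addr0; lra.
Qed.

Lemma sublinearZ q t x : sublinear q -> 0 <= t -> q (t *: x) = t * q x.
Proof.
move=> qS t0; have [qD qZ] := qS.
have [->|tn0] := eqVneq t 0; first by rewrite scale0r sublinear0// mul0r.
have tp : 0 < t by rewrite lt_neqAle eq_sym tn0.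
apply/eqP; rewrite eq_le qZ//= -ler_pdivlMl//.
have := qZ t^-1 (t *: x); rewrite scalerA mulVf// scale1r; apply.
by rewrite invr_ge0.
Qed.

Lemma sublinearN q x : sublinear q -> - q (- x) <= q x.
Proof. by move=> qS; have := qS.1 x (- x); rewrite subrr sublinear0//; lra. Qed.

(** All the sublinear functionals of the proof arise in this way: up to upward
    closure, [E] is the graph of a convex cone in [V * R], and the infimum over
    its fibres is the functional with that epigraph. *)
Lemma inf_sublinear (E : V -> set R) :
  (forall x, has_inf (E x)) ->
  (forall x y s t, E x s -> E y t -> exists2 u, E (x + y) u & u <= s + t) ->
  (forall (l : R) x s, 0 <= l -> E x s ->
    exists2 u, E (l *: x) u & u <= l * s) ->
  sublinear (fun x => inf (E x)).
Proof.
move=> Einf ED EZ.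
have Elb x s : E x s -> inf (E x) <= s.
  by move=> ?; apply: ge_inf; case: (Einf x).
split=> /= [x y|l x l0].
  rewrite -lerBlDr; apply: lb_le_inf; first by case: (Einf x).
  move=> s Es; rewrite lerBlDr -lerBlDl.
  apply: lb_le_inf; first by case: (Einf y).
  move=> t Et; have [u Eu us] := ED _ _ _ _ Es Et.
  by have := Elb _ _ Eu; lra.
have EZ' s : E x s -> inf (E (l *: x)) <= l * s.
  move=> Es; have [u Eu us] := EZ l x s l0 Es.
  exact: le_trans (Elb _ _ Eu) us.
have [s0 Es0] : E x !=set0 by case: (Einf x).
have [l_eq0|ln0] := eqVneq l 0.
  by have := EZ' _ Es0; rewrite l_eq0 !mul0r.
have lp : 0 < l by rewrite lt_neqAle eq_sym ln0.
rewrite -ler_pdivrMl//; apply: lb_le_inf; first by exists s0.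
by move=> s Es; rewrite ler_pdivrMl// EZ'.
Qed.

Lemma inf_fibre_le (E : V -> set R) x s :
  has_inf (E x) -> E x s -> inf (E x) <= s.
Proof. by move=> [_ lbE] Es; exact: ge_inf. Qed.

(** For a fixed [v], the functional [x |-> inf_t q (x + t v) - t q v] is
    sublinear and lies below [q]. If [q] is minimal the two agree, so
    [q x <= q (x + v) - q v], the reverse of subadditivity. *)
Lemma minimal_sublinear_additive q : sublinear q ->
  (forall q', sublinear q' -> (forall x, q' x <= q x) -> q' = q) ->
  forall x y, q (x + y) = q x + q y.
Proof.
move=> qS qmin x v; have [qD qZ] := qS.
pose E x := [set q (x + t *: v) - t * q v | t in [set t | 0 <= t]].
have Einf y : has_inf (E y).
  split; first by exists (q (y + 0 *: v) - 0 * q v); exists 0 => //=.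
  exists (- q (- y)) => _ [t /= t0 <-].
  have := qD (y + t *: v) (- y).
  by rewrite addrAC subrr add0r sublinearZ//; lra.
have ES : sublinear (fun y => inf (E y)).
  apply: inf_sublinear => //.
    move=> y z _ _ [s /= s0 <-] [t /= t0 <-].
    exists (q (y + z + (s + t) *: v) - (s + t) * q v).
      by exists (s + t) => //=; exact: addr_ge0.
    have := qD (y + s *: v) (z + t *: v).
    by rewrite addrACA -scalerDl; lra.
  move=> l y _ l0 [s /= s0 <-].
  exists (q (l *: y + (l * s) *: v) - (l * s) * q v).
    by exists (l * s) => //=; exact: mulr_ge0.
  by have := qZ l (y + s *: v) l0; rewrite scalerDr scalerA; lra.
have Eq : (fun y => inf (E y)) = q.
  apply: qmin => // y; apply: (inf_fibre_le (Einf y)).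
  by exists 0 => //=; rewrite scale0r addr0 mul0r subr0.
have : inf (E x) <= q (x + v) - q v.
  apply: (inf_fibre_le (Einf x)); exists 1 => //=.
  by rewrite scale1r mul1r.
have -> : inf (E x) = q x by rewrite -[in RHS]Eq.
by have := qD x v; lra.
Qed.

Lemma sublinear_additive_linear q : sublinear q ->
  (forall x y, q (x + y) = q x + q y) -> linear (q : V -> R^o).
Proof.
move=> qS qA t x y; rewrite qA; congr (_ + _).
have qN z : q (- z) = - q z.
  by have := qA z (- z); rewrite subrr sublinear0//; lra.
have [t0|t0] := leP 0 t; first exact: sublinearZ.
have := @sublinearZ q (- t) x qS.
rewrite oppr_ge0 ltW// => /(_ isT); rewrite scaleNr qN mulNr.
exact: oppr_inj.
Qed.

(** Zorn's lemma provides a minimal sublinear functional below [p], and a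
    minimal one is linear. The pointwise infimum of a chain is a lower bound
    for it; it is finite since [q x >= - q (- x)], and subadditive since two
    members of a chain can be replaced by the smaller one. *)
Theorem hahn_banach p : sublinear p ->
  exists2 l : V -> R^o, linear l & forall x, l x <= p x.
Proof.
move=> pS.
pose below q := sublinear q /\ forall x, q x <= p x.
pose T := {q : V -> R | below q}.
pose r (q1 q2 : T) := `[< forall x, sval q2 x <= sval q1 x >].
have [|||A Atot|q qmin] := @Zorn T r.
- by move=> q; apply/asboolP.
- move=> q1 q2 q3 /asboolP q12 /asboolP q23; apply/asboolP => x.
  exact: le_trans (q23 x) (q12 x).
- move=> [q1 h1] [q2 h2] /asboolP /= q12 /asboolP /= q21.
  apply: eq_exist; apply/funext => x; apply/eqP.
  by rewrite eq_le q12 q21.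
- have [->|/set0P[q0 Aq0]] := eqVneq A set0.
    by exists (exist below p (conj pS (fun x => lexx (p x)))).
  pose E x := [set sval q x | q in A].
  have Eq (q : T) x : A q -> E x (sval q x) by move=> Aq; exists q.
  have Einf x : has_inf (E x).
    split; first by exists (sval q0 x); exact: Eq.
    exists (- sval q0 (- x)) => _ [q Aq <-].
    have /= qN := sublinearN x (svalP q).1.
    have /= q0N := sublinearN x (svalP q0).1.
    have [/asboolP q0q|/asboolP qq0] := Atot _ _ Aq0 Aq.
      by have := q0q (- x); lra.
    by have := qq0 x; lra.
  have ES : sublinear (fun x => inf (E x)).
    apply: inf_sublinear => //.
      move=> x y _ _ [q1 Aq1 <-] [q2 Aq2 <-].
      have [/asboolP q12|/asboolP q21] := Atot _ _ Aq1 Aq2.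
        exists (sval q2 (x + y)); first exact: Eq.
        by have := (svalP q2).1.1 x y; have := q12 x; lra.
      exists (sval q1 (x + y)); first exact: Eq.
      by have := (svalP q1).1.1 x y; have := q21 y; lra.
    move=> l x _ l0 [q Aq <-]; exists (sval q (l *: x)); first exact: Eq.
    exact: (svalP q).1.2.
  have Ep x : inf (E x) <= p x.
    exact: le_trans (inf_fibre_le (Einf x) (Eq _ x Aq0)) ((svalP q0).2 x).
  exists (exist below (fun x => inf (E x)) (conj ES Ep)) => q Aq.
  apply/asboolP => x /=.
  exact: (inf_fibre_le (Einf x) (Eq _ x Aq)).
have [qS qp] := svalP q; exists (sval q) => //.
apply: sublinear_additive_linear => //; apply: minimal_sublinear_additive => //.
move=> q' q'S q'q.
have q'p x : q' x <= p x by apply: le_trans (qp x).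
have rq : r q (exist below q' (conj q'S q'p)) by apply/asboolP.
exact: (congr1 sval (qmin _ rq)).
Qed.

End Sublinear.

(** A continuous functional is prescribed from below on a convex cone: [D d t]
    demands [t <= xi d]. Such a [xi] exists as soon as the prescription is
    bounded by a multiple of the norm: take [xi] linear below the sublinear
    functional [x |-> inf (K * |x + d| - t)]. *)
Lemma dominating_dual (V : normedModType R) (D : V -> R -> Prop) (K : R) :
  0 <= K -> D 0 0 ->
  (forall x y s t, D x s -> D y t -> D (x + y) (s + t)) ->
  (forall (l : R) x s, 0 <= l -> D x s -> D (l *: x) (l * s)) ->
  (forall x t, D x t -> t <= K * `|x|) ->
  exists2 xi : tdual V, (forall v, `|xi v| <= K * `|v|) &
    forall x t, D x t -> t <= xi x.
Proof.
move=> K0 D0 DD DZ DK.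
pose E x := [set K * `|x + dt.1| - dt.2 | dt in [set dt | D dt.1 dt.2]].
have Einf x : has_inf (E x).
  split; first by exists (K * `|x + 0| - 0); exists (0, 0).
  exists (- (K * `|x|)) => _ [[d t] /= /DK tK <-].
  suff : K * `|d| <= K * `|x + d| + K * `|x| by lra.
  rewrite -mulrDr ler_wpM2l// addrC -(normrN x).
  by rewrite -[in leLHS](addKr x d) ler_normD.
have ES : sublinear (fun x => inf (E x)).
  apply: inf_sublinear => //.
    move=> x y _ _ [[d s] /= Ds <-] [[e t] /= Dt <-].
    exists (K * `|x + y + (d + e)| - (s + t)).
      by exists (d + e, s + t) => //=; exact: DD.
    suff : K * `|x + y + (d + e)| <= K * `|x + d| + K * `|y + e| by lra.
    by rewrite -mulrDr ler_wpM2l// addrACA ler_normD.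
  move=> l x _ l0 [[d s] /= Ds <-].
  exists (K * `|l *: x + l *: d| - l * s).
    by exists (l *: d, l * s) => //=; exact: DZ.
  by rewrite -scalerDr normrZ ger0_norm// mulrBr mulrCA.
have [l lL lE] := hahn_banach ES.
pose L : {linear V -> R^o} := HB.pack l (GRing.isLinear.Build _ _ _ _ l lL).
have LE x d t : D d t -> L x <= K * `|x + d| - t.
  move=> Dd; apply: le_trans (lE x) _; apply: (inf_fibre_le (Einf x)).
  by exists (d, t).
have LK x : L x <= K * `|x| by have := LE x _ _ D0; rewrite addr0 subr0.
have bL x : `|L x| <= K * `|x|.
  rewrite ler_norml LK andbT.
  by have := LK (- x); rewrite linearN normrN; lra.
have xiP : (L : V -> R^o) \in @cont_linear R V.
  by apply/cont_linearP; split; [exact: lL|exists K].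
exists (Dual xiP) => // x t Dx.
by move: (LE (- x) _ _ Dx); rewrite addNr normr0 mulr0 linearN sub0r lerN2.
Qed.

End HahnBanach.

(** * From bounded domination to the bidual *)

Section DualArithmetic.
Context (R : realType) (V : normedModType R).
Implicit Types (eta : tdual V) (u v : V).

Lemma dual0 eta : eta 0 = 0 :> R.
Proof. exact: linear0. Qed.

Lemma dualD eta u v : eta (u + v) = eta u + eta v :> R.
Proof. exact: linearD. Qed.

Lemma dualZ eta (t : R) u : eta (t *: u) = t * eta u :> R.
Proof. exact: linearZ. Qed.

Lemma dualB eta u v : eta (u - v) = eta u - eta v :> R.
Proof. exact: linearB. Qed.

End DualArithmetic.

Section Domination.
Context (R : realType) (V : normedModType R) (P H : set V).

Definition cone := [/\ P 0, forall u v, P u -> P v -> P (u + v) &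
  forall (t : R) u, 0 <= t -> P u -> P (t *: u)].

Definition lsubspace := H 0 /\ forall (t : R) u v, H u -> H v -> H (t *: u + v).

(** The order on [V] is the one with positive cone [P]. The norm control is what
    turns, in the dual, into the error bound below. *)
Definition bounded_domination (C : R) := forall v w, H w -> P (w - v) ->
  exists w', [/\ H w', P (w' - v) & `|w'| <= C * `|v|].

Lemma lsubspaceZ t u : lsubspace -> H u -> H (t *: u).
Proof. by move=> [H0 HP] Hu; have := HP t u 0 Hu H0; rewrite addr0. Qed.

Lemma lsubspaceD u v : lsubspace -> H u -> H v -> H (u + v).
Proof. by move=> [H0 HP] Hu Hv; have := HP 1 u v Hu Hv; rewrite scale1r. Qed.

Lemma lsubspaceN u : lsubspace -> H u -> H (- u).
Proof. by move=> HS /(lsubspaceZ (-1) HS); rewrite scaleN1r. Qed.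

Context (coneP : cone) (subH : lsubspace).

(** For the correction [xi = eta' - eta], what is required is [xi >= - eta]
    on [P] and [xi = - eta] on [H], that is, [xi (u - w) >= - eta (u - w)] for
    [u] in [P] and [w] in [H]. This prescription is bounded: [w - u], which is
    dominated by [w], is dominated by some [w'] in [H] of comparable norm, and
    [eta (w - u) <= eta w' = (eta + n) w']. *)
Lemma dual_error_bound (C : R) (eta n : tdual V) :
  0 <= C -> bounded_domination C ->
  dual_cone P eta -> annihilator H n ->
  exists eta', [/\ dual_cone P eta', annihilator H eta' &
                   `|eta' - eta| <= C * `|eta + n|].
Proof.
move=> C0 domH eta0 nH.
have [P0 PD PZ] := coneP.
pose D d t := exists u w, [/\ P u, H w, d = u - w & t = - eta d].
have [|||||xi xiK xiD] := @dominating_dual R V D (C * `|eta + n|).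
- exact: mulr_ge0.
- exists 0, 0; split=> //; first exact: subH.1.
    by rewrite subr0.
  by rewrite dual0 oppr0.
- move=> _ _ _ _ [u [w [Pu Hw -> ->]]] [u' [w' [Pu' Hw' -> ->]]].
  exists (u + u'), (w + w'); split; [exact: PD|exact: lsubspaceD| |].
    by rewrite opprD addrACA.
  by rewrite [in RHS]linearD opprD.
- move=> l _ _ l0 [u [w [Pu Hw -> ->]]].
  exists (l *: u), (l *: w); split; [exact: PZ|exact: lsubspaceZ| |].
    by rewrite scalerBr.
  by rewrite linearZ/= mulrN.
- move=> _ _ [u [w [Pu Hw -> ->]]].
  have [|w' [Hw' Pw' w'C]] := domH (w - u) w Hw.
    by rewrite opprB addrC subrK.
  have eta_w' : eta (w - u) <= eta w'.
    by have := eta0 _ Pw'; rewrite linearB subr_ge0.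
  have : eta w' <= `|eta + n| * `|w'|.
    have := ler_dual_norm (eta + n) w'; rewrite -[(eta + n) w']/(eta w' + n w').
    by rewrite nH// addr0; apply: le_trans; exact: ler_norm.
  have : `|eta + n| * `|w'| <= C * `|eta + n| * `|u - w|.
    by rewrite mulrAC mulrC ler_wpM2r// -(normrN (u - w)) opprB.
  by move: eta_w'; rewrite -(opprB u w) linearN; lra.
have eta'E v : (eta + xi) v = eta v + xi v by [].
have xiH w : H w -> 0 <= eta w + xi w.
  move=> Hw; have : - eta w <= xi w; last by lra.
  apply: xiD; exists 0, (- w); split=> //; first exact: lsubspaceN.
  by rewrite opprK add0r.
exists (eta + xi); split.
- move=> u Pu; rewrite eta'E; have : - eta u <= xi u; last by lra.
  apply: xiD; exists u, 0; split=> //; first exact: subH.1.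
  by rewrite subr0.
- move=> w Hw; rewrite eta'E; have := xiH _ Hw.
  by have := xiH _ (lsubspaceN subH Hw); rewrite !linearN; lra.
- rewrite addrC addKr; apply: dual_norm_ler => [|v v1]; first exact: mulr_ge0.
  apply: le_trans (xiK v) _; rewrite -[leRHS]mulr1 ler_wpM2l//.
  exact: mulr_ge0.
Qed.

(** The error bound makes the prescription [W = 0] on the annihilator of [H]
    and [W >= z] on the positive cone bounded, hence solvable by an element [W]
    of the bidual: for positive [u], moving to the nearby [u'] where [z u' <= 0]
    bounds [z u] by a multiple of the distance from [u] to the annihilator. *)
Lemma bidual_domination (C : R) (z : tdual (tdual V)) :
  0 <= C -> bounded_domination C ->
  (forall eta, dual_cone P eta -> annihilator H eta -> z eta <= 0) ->
  exists2 W, annihilator (annihilator H) W &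
    forall eta, dual_cone P eta -> z eta <= W eta.
Proof.
move=> C0 domH z0.
pose D eta t := exists u n, [/\ dual_cone P u, annihilator H n,
  eta = u + n & t = z u].
have [|||||W _ WD] := @dominating_dual R (tdual V) D (`|z| * C).
- exact: mulr_ge0.
- by exists 0, 0; split; rewrite ?addr0 ?linear0.
- move=> _ _ _ _ [u [n [u0 nH -> ->]]] [u' [n' [u'0 n'H -> ->]]].
  exists (u + u'), (n + n'); split.
  + by move=> v Pv; apply: addr_ge0; [exact: u0|exact: u'0].
  + by move=> v Hv; rewrite -[LHS]/(n v + n' v) nH// n'H// addr0.
  + by rewrite addrACA.
  + by rewrite linearD.
- move=> l _ _ l0 [u [n [u0 nH -> ->]]].
  exists (l *: u), (l *: n); split.
  + by move=> v Pv; apply: mulr_ge0 => //; exact: u0.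
  + by move=> v Hv; rewrite -[LHS]/(l * n v) nH// mulr0.
  + by rewrite scalerDr.
  + by rewrite linearZ.
- move=> _ _ [u [n [u0 nH -> ->]]].
  have [u' [u'0 u'H u'u]] := dual_error_bound C0 domH u0 nH.
  have := z0 _ u'0 u'H; have := ler_dual_norm z (u' - u).
  rewrite -(normrN (z _)) -linearN opprB linearB => zu.
  have := ler_norm (z u - z u').
  have : `|z| * `|u' - u| <= `|z| * C * `|u + n| by rewrite -mulrA ler_wpM2l.
  by lra.
exists W => [n nH|eta eta0].
  have WH m : annihilator H m -> 0 <= W m.
    move=> mH; apply: WD; exists 0, m; split=> //; first by rewrite add0r.
    by rewrite linear0.
  apply/eqP; rewrite eq_le WH// andbT -oppr_ge0 -linearN WH// => v Hv.
  by rewrite -[LHS]/(- n v) nH// oppr0.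
apply: WD; exists eta, 0; split=> //; first by rewrite addr0.
Qed.

End Domination.

Section DominationByALine.
Context (R : realType) (V : normedModType R) (P H : set V).

Lemma lsubspace_line (v : V) : lsubspace H -> lsubspace (setadd H (line v)).
Proof.
move=> HS; split.
  exists 0; first exact: HS.1.
  by exists 0; [exists 0; rewrite ?scale0r|rewrite addr0].
move=> t _ _ [w Hw [_ [a _ <-] <-]] [w' Hw' [_ [a' _ <-] <-]].
exists (t *: w + w'); first exact: HS.2.
exists (t *: (a *: v) + a' *: v); last by rewrite scalerDr addrACA.
by exists (t * a + a') => //; rewrite scalerA scalerDl.
Qed.

(** Two positive functionals that annihilate [H] and give [v] opposite signs
    bound, from both sides, the coefficient [a] of [v] in a domination
    [u <= w + a v]; subtracting [a v] then reduces it to one by [H]. *)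
Lemma bounded_domination_line (C : R) (v : V) (e1 e2 : tdual V) :
  0 <= C -> bounded_domination P H C ->
  dual_cone P e1 -> annihilator H e1 -> dual_cone P e2 -> annihilator H e2 ->
  e1 v < 0 -> 0 < e2 v ->
  exists2 C', 0 <= C' & bounded_domination P (setadd H (line v)) C'.
Proof.
move=> C0 domH e1P e1H e2P e2H e1v e2v.
pose A := `|e1| / - e1 v + `|e2| / e2 v.
have A1 : 0 <= `|e1| / - e1 v by rewrite divr_ge0// oppr_ge0 ltW.
have A2 : 0 <= `|e2| / e2 v by rewrite divr_ge0// ltW.
have A0 : 0 <= A by exact: addr_ge0.
exists (C * (1 + A * `|v|) + A * `|v|).
  by apply: addr_ge0; apply: mulr_ge0 => //; rewrite addr_ge0// mulr_ge0.
move=> u _ [w Hw [_ [a _ <-] <-]] Pu.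
have eP e : dual_cone P e -> annihilator H e -> - (`|e| * `|u|) <= a * e v.
  move=> eP eH; have := eP _ Pu.
  rewrite linearB linearD linearZ/= eH// add0r subr_ge0; apply: le_trans.
  by have := ler_dual_norm e u; rewrite ler_norml => /andP[].
have aA : `|a| <= A * `|u|.
  rewrite ler_norml mulrDl; apply/andP; split.
    suff : - (`|e2| / e2 v * `|u|) <= a.
      by have := mulr_ge0 A1 (normr_ge0 u); lra.
    by rewrite mulrAC -mulNr ler_pdivrMr// eP.
  suff : a <= `|e1| / - e1 v * `|u|.
    by have := mulr_ge0 A2 (normr_ge0 u); lra.
  rewrite mulrAC ler_pdivlMr ?oppr_gt0//.
  by rewrite mulrN lerNl eP.
have [|w' [Hw' Pw' w'C]] := domH (u - a *: v) w Hw.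
   by rewrite opprB addrA.
exists (w' + a *: v); split.
- by exists w' => //; exists (a *: v) => //; exists a.
- by move: Pw'; rewrite opprB addrA.
have av : `|a *: v| <= A * `|v| * `|u|.
  by rewrite normrZ mulrAC ler_wpM2r.
have : `|u - a *: v| <= (1 + A * `|v|) * `|u|.
  by rewrite (le_trans (ler_normB _ _))// mulrDl mul1r lerD2l.
move=> /(ler_wpM2l C0); rewrite mulrA => uC.
rewrite (le_trans (ler_normD _ _))// mulrDl lerD//.
exact: le_trans w'C uC.
Qed.

End DominationByALine.

(** * States on bounded continuous functions *)

Section States.
Context (R : realType) (T : topologicalType).
Local Notation Cb := (bcfun R T).
Implicit Types (eta : tdual Cb) (u v w : Cb).

Lemma bc_pos_cone : cone (@bc_pos R T).
Proof.
split=> [x//|u v u0 v0 x|t u t0 u0 x]; first exact: addr_ge0 (u0 x) (v0 x).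
exact: mulr_ge0 t0 (u0 x).
Qed.

Lemma bc_pos_bound (v : Cb) : bc_pos (`|v| *: bc_one R T - v).
Proof.
move=> x; have := ler_norm (v x); have := ler_bcnorm v x.
rewrite -[X in _ -> _ -> _ <= X]/(`|v| * 1 - v x); lra.
Qed.

Lemma dual_pos_le eta u v :
  dual_pos eta -> (forall x, u x <= v x) -> eta u <= eta v.
Proof.
move=> eta0 uv; have := eta0 (v - u); rewrite linearB subr_ge0; apply => x.
by rewrite -[leRHS]/(v x - u x) subr_ge0.
Qed.

Lemma dual_pos_norm eta v : dual_pos eta -> `|eta v| <= eta (bc_one R T) * `|v|.
Proof.
move=> eta0; have le w : eta w <= eta (bc_one R T) * `|w|.
  have := eta0 _ (bc_pos_bound w).
  by rewrite linearB linearZ subr_ge0 /= mulrC.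
rewrite ler_norml le andbT lerNl.
by have := le (- v); rewrite linearN normrN.
Qed.

Lemma states_norm eta : states eta -> `|eta| <= 1.
Proof.
move=> [eta0 eta1]; apply: dual_norm_ler => // v v1.
by rewrite (le_trans (dual_pos_norm v eta0))// eta1 mul1r.
Qed.

Lemma dual_pos_ge0_states eta : dual_pos eta -> eta = 0 \/
  exists2 e, states e & exists2 t, 0 <= t & eta = t *: e.
Proof.
move=> eta0.
have t0 : 0 <= eta (bc_one R T) by apply: eta0 => x; exact: ler01.
have [etaE|tn0] := eqVneq (eta (bc_one R T)) 0.
  left; apply: val_inj; apply/funext => v; apply/eqP; rewrite -normr_le0.
  by have := dual_pos_norm v eta0; rewrite etaE mul0r.
right; exists ((eta (bc_one R T))^-1 *: eta); last first.
  by exists (eta (bc_one R T)) => //; rewrite scalerA mulfV// scale1r.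
split; last by rewrite -[LHS]/(_ * _) mulVf.
by move=> v v0; apply: mulr_ge0 (eta0 _ v0); rewrite invr_ge0.
Qed.

Lemma states_convex e1 e2 (t : R) :
  states e1 -> states e2 -> 0 <= t -> t <= 1 ->
  @states R T (t *: e1 + (1 - t) *: e2).
Proof.
move=> [e1P e11] [e2P e21] t0 t1; split.
  move=> v v0; apply: addr_ge0; first exact: mulr_ge0 (e1P _ v0).
  by apply: mulr_ge0 (e2P _ v0); rewrite subr_ge0.
rewrite -[LHS]/(t * e1 _ + (1 - t) * e2 _) e11 e21; lra.
Qed.

(** Being nonnegative on the positive cone, zero on [H] and [1] at the constant
    [1] is a prescription bounded by the norm, because no element of [H] lies
    below a negative constant. *)
Lemma exists_state_annihilator (H : set Cb) : lsubspace H ->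
  (forall w c, H w -> (forall x, w x <= c) -> 0 <= c) ->
  exists2 eta, states eta & annihilator H eta.
Proof.
move=> HS Hub.
have [pos0 posD posZ] := bc_pos_cone.
pose D v t := exists u w, [/\ bc_pos u, H w & v = u + w + t *: bc_one R T].
have [|||||xi _ xiD] := @dominating_dual R Cb D 1.
- exact: ler01.
- by exists 0, 0; split=> //; [exact: HS.1|rewrite scale0r !addr0].
- move=> _ _ s t [u [w [u0 Hw ->]]] [u' [w' [u'0 Hw' ->]]].
  exists (u + u'), (w + w'); split; [exact: posD|exact: lsubspaceD|].
  by rewrite scalerDl addrACA; congr (_ + _); rewrite addrACA.
- move=> l _ t l0 [u [w [u0 Hw ->]]].
  exists (l *: u), (l *: w); split; [exact: posZ|exact: lsubspaceZ|].
  by rewrite !scalerDr scalerA.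
- move=> _ t [u [w [u0 Hw ->]]]; rewrite mul1r -subr_ge0.
  apply: (Hub w) => // x.
  have := ler_norm ((u + w + t *: bc_one R T) x).
  have := ler_bcnorm (u + w + t *: bc_one R T) x.
  rewrite -[(u + w + t *: bc_one R T) x]/(u x + w x + t * 1).
  by have := u0 x; lra.
exists xi; first split.
- move=> u u0; apply: xiD; exists u, 0; split=> //; first exact: HS.1.
  by rewrite scale0r !addr0.
- have D1 (t : R) : t <= xi (t *: bc_one R T).
    by apply: xiD; exists 0, 0; split=> //; [exact: HS.1|rewrite !add0r].
  have := D1 1; have := D1 (-1); rewrite scaleN1r scale1r linearN; lra.
- have xiH w : H w -> 0 <= xi w.
    move=> Hw; apply: xiD; exists 0, w; split=> //.
    by rewrite scale0r addr0 add0r.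
  move=> w Hw; have := xiH _ Hw; have := xiH _ (lsubspaceN HS Hw).
  by rewrite linearN; lra.
Qed.

Lemma integral_dual_states (t0 : T) (mu : probability (borel t0) R) :
  states (integral_dual mu).
Proof.
split.
  by move=> v v0; apply: Rintegral_ge0 => x _; exact: v0.
rewrite -[LHS]/(\int[mu]_(x in [set: borel t0]) (1 : R)) Rintegral_cst//.
have := probability_setT mu; rewrite /= => ->; by rewrite mulr1.
Qed.

Lemma bc_min_subproof (h : Cb) (c : R) :
  (fun x => Num.min (h x) c : R^o) \in @bcont R T.
Proof.
apply/bcontP; split.
  move=> x; apply: (@continuous_min _ _ h (fun=> c)); last exact: cvg_cst.
  exact: bcfun_cont.
exists (`|h| + `|c|) => x; have := ler_bcnorm h x; rewrite ler_norml => /andP[].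
have := normr_ge0 c; have := normr_ge0 h.
have := ler_norm c; have := ler_norm (- c); rewrite normrN => ? ? ? ? ? ?.
by rewrite ler_norml; case: (leP (h x) c) => ?; apply/andP; split; lra.
Qed.

Definition bc_min (h : Cb) (c : R) : Cb := BCFun (bc_min_subproof h c).

End States.

(** * Couplings and their linear constraints *)

Section FiniteSums.
Context (W : nmodType) (N : nat) (k : 'I_N).

Lemma sum_ltnS (F : 'I_N -> W) :
  \sum_(i < N | (i < k.+1)%N) F i = \sum_(i < N | (i < k)%N) F i + F k.
Proof.
rewrite (bigD1 k)//= addrC; congr (_ + _); apply: eq_bigl => i.
by rewrite ltnS (ltn_neqAle i) andbC.
Qed.

Lemma sum_ltnS_update (I : Type) (c : 'I_N -> I) (t : I) (F : 'I_N -> I -> W) :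
  \sum_(i < N | (i < k.+1)%N) F i (if i == k then t else c i) =
  \sum_(i < N | (i < k)%N) F i (c i) + F k t.
Proof.
rewrite sum_ltnS eqxx; congr (_ + _).
by apply: eq_bigr => i ik; case: eqP ik => // ->; rewrite ltnn.
Qed.

End FiniteSums.

Section Transport.
Context (R : realType) (X Y : topologicalType) (x0 : X) (y0 : Y).
Context (mu : probability (borel x0) R) (nu : probability (borel y0) R).
Local Notation Cb := (bcfun R (X * Y)%type).
Local Notation pos := (@bc_pos R (X * Y)%type).
Local Notation m := (integral_dual mu).
Local Notation n := (integral_dual nu).

Let mP : dual_pos m := (integral_dual_states mu).1.
Let m1 : m (bc_one R X) = 1 := (integral_dual_states mu).2.
Let nP : dual_pos n := (integral_dual_states nu).1.
Let n1 : n (bc_one R Y) = 1 := (integral_dual_states nu).2.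

Lemma Hot_lsubspace : lsubspace (Hot mu nu).
Proof.
split.
  exists 0, 0; split; rewrite ?dual0//.
  by apply: val_inj; apply/funext => p /=; rewrite addr0.
move=> t _ _ [h [g [mh ng ->]]] [h' [g' [mh' ng' ->]]].
exists (t *: h + h'), (t *: g + g'); split; last by rewrite oplus_linear.
  by rewrite dualD dualZ mh mh' mulr0 addr0.
by rewrite dualD dualZ ng ng' mulr0 addr0.
Qed.

(** Integrating first in [x], then in [y], as the product measure would. *)
Lemma Hot_ub (w : Cb) (c : R) : Hot mu nu w -> (forall p, w p <= c) -> 0 <= c.
Proof.
move=> [h [g [mh ng ->]]] wc.
have gc y : g y <= (c *: bc_one R Y) y.
  have : m h <= m ((c - g y) *: bc_one R X).
    apply: dual_pos_le => // x; have := wc (x, y).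
    rewrite -[(oplus h g) (x, y)]/(h x + g y).
    by rewrite -[((c - g y) *: bc_one R X) x]/((c - g y) * 1); lra.
  rewrite mh dualZ m1.
  by rewrite -[(c *: bc_one R Y) y]/(c * 1); lra.
have := dual_pos_le nP gc.
by rewrite ng dualZ n1 mulr1.
Qed.

(** Let [v <= oplus h g] and [M = |v|]. Moving a constant between [h] and [g]
    makes [h >= - M] and [g >= 0]; truncating [h] at [M] and [g] at [2 M] then
    keeps the sum above [v]. Truncation only lowers the integrals, so
    recentring the two functions adds a nonnegative constant to the sum. *)
Lemma Hot_bounded_domination : bounded_domination pos (Hot mu nu) 6.
Proof.
move=> v _ [h [g [mh ng ->]]] vw.
set M := `|v|; have M0 : 0 <= M by exact: normr_ge0.
have vM p : - M <= v p <= M by rewrite -ler_norml ler_bcnorm.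
have vhg x y : v (x, y) <= h x + g y by have := vw (x, y); rewrite subr_ge0.
pose s := sup [set - g y | y in [set: Y]].
have sg y : - g y <= s.
  apply: ub_le_sup; last by exists y.
  exists `|g| => _ [z _ <-].
  by rewrite (le_trans (ler_norm _))// normrN ler_bcnorm.
have sh x : s <= h x + M.
  apply: ge_sup; first by exists (- g y0), y0.
  by move=> _ [y _ <-]; have := vhg x y; have /andP[] := vM (x, y); lra.
pose h1 := h - s *: bc_one R X; pose g1 := g + s *: bc_one R Y.
have h1E x : h1 x = h x - s by rewrite -[LHS]/(h x - s * 1) mulr1.
have g1E y : g1 y = g y + s by rewrite -[LHS]/(g y + s * 1) mulr1.
pose h2 := bc_min h1 M; pose g2 := bc_min g1 (2 * M).
have h2E x : h2 x = Num.min (h x - s) M by rewrite -h1E.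
have g2E y : g2 y = Num.min (g y + s) (2 * M) by rewrite -g1E.
have h2M : `|h2| <= M.
  apply: bcnorm_ler => // x; rewrite h2E ler_norml; have := sh x.
  by case: (leP (h x - s) M) => ? ?; apply/andP; split; lra.
have g2M : `|g2| <= 2 * M.
  apply: bcnorm_ler => [|y]; first lra.
  rewrite g2E ler_norml; have := sg y.
  by case: (leP (g y + s) (2 * M)) => ? ?; apply/andP; split; lra.
have mh2 : m h2 <= - s.
  have -> : - s = m h1 by rewrite dualB dualZ mh m1; lra.
  by apply: dual_pos_le => // x; rewrite h2E h1E ge_min lexx.
have ng2 : n g2 <= s.
  have -> : s = n g1 by rewrite dualD dualZ ng n1; lra.
  by apply: dual_pos_le => // y; rewrite g2E g1E ge_min lexx.
have mh2M : `|m h2| <= M.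
  by rewrite (le_trans (dual_pos_norm _ mP))// m1 mul1r.
have ng2M : `|n g2| <= 2 * M.
  by rewrite (le_trans (dual_pos_norm _ nP))// n1 mul1r.
pose h' := h2 - m h2 *: bc_one R X; pose g' := g2 - n g2 *: bc_one R Y.
have wE x y : oplus h' g' (x, y) = h2 x - m h2 + (g2 y - n g2).
  by rewrite -[LHS]/(h2 x - m h2 * 1 + (g2 y - n g2 * 1)) !mulr1.
exists (oplus h' g'); split.
- exists h', g'; split=> //.
    by rewrite dualB dualZ m1 mulr1 subrr.
  by rewrite dualB dualZ n1 mulr1 subrr.
- move=> [x y]; rewrite -[leRHS]/(oplus h' g' (x, y) - v (x, y)) wE h2E g2E.
  have := sh x; have := sg y; have := vhg x y; have /andP[] := vM (x, y).
  by case: (leP (h x - s) M); case: (leP (g y + s) (2 * M)); lra.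
  (* recentring doubles the norms: [6 = 2 * 1 + 2 * 2] *)
- apply: bcnorm_ler => [|[x y]]; first by rewrite mulr_ge0.
  rewrite wE; have := le_trans (ler_bcnorm h2 x) h2M.
  have := le_trans (ler_bcnorm g2 y) g2M; move: mh2M ng2M.
  rewrite -/M !ler_norml => /andP[? ?] /andP[? ?] /andP[? ?] /andP[? ?].
  by apply/andP; split; lra.
Qed.

Section Constraints.
Context (N : nat) (f : 'I_N -> Cb).
Local Notation H k := (Hk mu nu f k).
Local Notation Q k := (Qk mu nu f k).

Lemma Hk0 : H 0 = Hot mu nu.
Proof.
apply/seteqP; split => [_ [w [a [Hw ->]]]|w Hw].
  by rewrite big_pred0_eq addr0.
by exists w, (fun=> 0); rewrite big_pred0_eq addr0.
Qed.

Lemma HkS (k : 'I_N) : H k.+1 = setadd (H k) (line (f k)).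
Proof.
apply/seteqP; split.
  move=> _ [w [a [Hw ->]]].
  exists (w + \sum_(i < N | (i < k)%N) a i *: f i); first by exists w, a.
  by exists (a k *: f k); [exists (a k)|rewrite sum_ltnS addrA].
move=> _ [_ [w [a [Hw ->]]] [_ [t _ <-] <-]].
exists w, (fun i => if i == k then t else a i); split=> //.
by rewrite (sum_ltnS_update k a t (fun i b => b *: f i)) addrA.
Qed.

Lemma QkP (k : nat) eta : Q k eta ->
  [/\ states eta, dual_pos eta & annihilator (H k) eta].
Proof. by move=> [aH [eP e1]]. Qed.

Context (Hf : forall k : 'I_N,
      (ereal_inf [set (eta (f k))%:E | eta in Q k] < 0%:E)%E /\
      (0%:E < ereal_sup [set (eta (f k))%:E | eta in Q k])%E).

Lemma opposite_signs (k : 'I_N) : exists e1 e2,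
  [/\ Q k e1, Q k e2, e1 (f k) < 0 & 0 < e2 (f k)].
Proof.
have [/ereal_inf_lt[_ [e1 Q1 <-] e10] /ereal_sup_gt[_ [e2 Q2 <-] e20]] := Hf k.
by exists e1, e2; split; rewrite // -lte_fin.
Qed.

Lemma Hk_bounded_domination (k : nat) : (k <= N)%N ->
  lsubspace (H k) /\ exists2 C, 0 <= C & bounded_domination pos (H k) C.
Proof.
elim: k => [_|k IHk kN].
  rewrite Hk0; split; first exact: Hot_lsubspace.
  by exists 6 => //; exact: Hot_bounded_domination.
have [HS [C C0 domH]] := IHk (ltnW kN).
rewrite -[k]/(val (Ordinal kN)) HkS; split; first exact: lsubspace_line.
have [e1 [e2 [/QkP[_ e1P e1H] /QkP[_ e2P e2H] e10 e20]]] :=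
  opposite_signs (Ordinal kN).
exact: (bounded_domination_line C0 domH e1P e1H e2P e2H e10 e20).
Qed.

(** Without constraints this is the existence of a coupling; with constraints
    the last one is met by a convex combination of two states on which it has
    opposite signs. *)
Lemma Qcot_nonempty : Qcot mu nu f !=set0.
Proof.
rewrite /Qcot; case: (posnP N) => [N0|N0].
  have [eta eS eH] := exists_state_annihilator Hot_lsubspace Hot_ub.
  by exists eta; split => //; rewrite [N in Hk _ _ _ N]N0 Hk0.
have kN : (N.-1 < N)%N by rewrite prednK.
pose k := Ordinal kN.
have [e1 [e2 [/QkP[e1S _ e1H] /QkP[e2S _ e2H] e10 e20]]] := opposite_signs k.
have d0 : 0 < e2 (f k) - e1 (f k) by lra.
pose t := e2 (f k) / (e2 (f k) - e1 (f k)).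
have tE : t * (e2 (f k) - e1 (f k)) = e2 (f k) by rewrite divfK// gt_eqF.
exists (t *: e1 + (1 - t) *: e2); split.
  have Nk : N = k.+1 by rewrite /= prednK.
  rewrite [X in Hk _ _ _ X]Nk HkS => _ [w Hw [_ [a _ <-] <-]].
  rewrite dualD dualZ -[X in X + _]/(t * e1 w + (1 - t) * e2 w).
  rewrite -[X in a * X]/(t * e1 (f k) + (1 - t) * e2 (f k)) e1H// e2H//.
  have -> : t * e1 (f k) + (1 - t) * e2 (f k) = 0 by lra.
  by rewrite !mulr0 !addr0.
apply: states_convex => //; first by rewrite divr_ge0// ltW.
by rewrite ler_pdivrMr// mul1r; lra.
Qed.

End Constraints.

End Transport.

(** * Elements of the bidual *)

Section Annihilators.
Context (R : realType) (V : normedModType R).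

Lemma annihilator_lsubspace (H : set V) : lsubspace (annihilator H).
Proof.
split=> [//|t e e' eH e'H v Hv].
by rewrite -[LHS]/(t * e v + e' v) eH// e'H// mulr0 addr0.
Qed.

(** If [phi v0 != 0] for some [v0] in [M], then every [v] in [M] is the sum of a
    multiple of [v0] and an element of [M] in the kernel of [phi], so [z v]
    depends on [phi v] alone. *)
Lemma annihilator_ker (M : set V) (phi z : tdual V) : lsubspace M ->
  (forall v, M v -> phi v = 0 -> z v = 0) ->
  exists t, annihilator M (z - t *: phi).
Proof.
move=> MS zM; have zE t v : (z - t *: phi) v = z v - t * phi v by [].
have [[v0 [Mv0 phi0]]|nphi] := pselect (exists v0, M v0 /\ phi v0 != 0).
  exists (z v0 / phi v0) => v Mv; rewrite zE.
  have := zM ((- (phi v / phi v0)) *: v0 + v); rewrite !dualD !dualZ.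
  move=> /(_ (MS.2 _ _ _ Mv0 Mv)); rewrite mulNr divfK// addNr => /(_ erefl).
  by rewrite mulNr mulrAC [X in _ - X]mulrAC; lra.
exists 0 => v Mv; rewrite zE mul0r subr0 zM//.
by apply/eqP; apply: contra_notT nphi => ?; exists v.
Qed.

Lemma annihilator_setadd_line (H : set V) (v : V) (eta : tdual V) : H 0 ->
  annihilator (setadd H (line v)) eta <-> annihilator H eta /\ eta v = 0.
Proof.
move=> H0; split=> [etaH|[etaH ev] _ [w Hw [_ [a _ <-] <-]]]; last first.
  by rewrite dualD dualZ ev mulr0 addr0 etaH.
split=> [w Hw|]; apply: etaH.
  by exists w => //; exists 0; rewrite ?addr0//; exists 0; rewrite ?scale0r.
by exists 0 => //; exists v; rewrite ?add0r//; exists 1; rewrite ?scale1r.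
Qed.

Lemma big_setadd_line (N : nat) (v : 'I_N -> V) :
  \big[@setadd R V/[set 0]]_(i < N) line (v i) =
  [set \sum_(i < N) a i *: v i | a in [set: 'I_N -> R]].
Proof.
apply/seteqP; split; last first.
  move=> _ [a _ <-]; apply: (big_ind2 (fun w (A : set V) => A w)) => //.
    by move=> w A w' A' Aw A'w'; exists w => //; exists w'.
  by move=> i _; exists (a i).
apply: (big_ind (fun A : set V => A `<=`
    [set \sum_(i < N) a i *: v i | a in [set: 'I_N -> R]])).
- move=> _ ->; exists (fun=> 0) => //.
  by rewrite big1// => i _; rewrite scale0r.
- move=> A B AS BS _ [x /AS[a _ <-] [y /BS[b _ <-] <-]].
  exists (fun i => a i + b i) => //; rewrite -big_split; apply: eq_bigr => i _.
  by rewrite scalerDl.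
- move=> i _ _ [t _ <-]; exists (fun j => if j == i then t else 0) => //.
  rewrite (bigD1 i)//= eqxx big1 ?addr0// => j /negbTE ->.
  by rewrite scale0r.
Qed.

End Annihilators.

Section Adjoint.
Context (R : realType) (V W : normedModType R) (T : V -> W).
Context (TL : linear T) (TN : forall v, `|T v| <= `|v|).

Lemma adjoint_subproof (eta : tdual W) :
  (fun v => eta (T v) : R^o) \in @cont_linear R V.
Proof.
apply/cont_linearP; split; first by move=> a u v; rewrite TL linearP.
by exists `|eta| => v; rewrite (le_trans (ler_dual_norm _ _))// ler_wpM2l.
Qed.

Definition adjoint (eta : tdual W) : tdual V := Dual (adjoint_subproof eta).

Lemma adjoint_linear : linear adjoint.
Proof. by move=> a e e'; exact: val_inj. Qed.

Lemma adjoint_norm eta : `|adjoint eta| <= `|eta|.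
Proof.
apply: dual_norm_ler => // v v1; apply: le_trans (ler_dual_norm eta (T v)) _.
by rewrite ler_piMr// (le_trans (TN v)).
Qed.

End Adjoint.

Section BidualOfMarginals.
Context (R : realType) (X Y : topologicalType) (x0 : X) (y0 : Y).
Local Notation Cb := (bcfun R (X * Y)%type).

Lemma bc_comp_subproof (S T : topologicalType) (phi : S -> T)
    (phiC : continuous phi) (v : bcfun R T) :
  (fun s => v (phi s) : R^o) \in @bcont R S.
Proof.
apply/bcontP; split.
  by move=> s; apply: continuous_comp; [exact: phiC|exact: bcfun_cont].
by exists `|v| => s; exact: ler_bcnorm.
Qed.

Definition bc_comp (S T : topologicalType) (phi : S -> T)
    (phiC : continuous phi) (v : bcfun R T) : bcfun R S :=
  BCFun (bc_comp_subproof phiC v).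

Lemma bc_comp_linear (S T : topologicalType) (phi : S -> T)
  (phiC : continuous phi) : linear (bc_comp phiC).
Proof. by move=> a u v; exact: val_inj. Qed.

Lemma bc_comp_norm (S T : topologicalType) (phi : S -> T)
  (phiC : continuous phi) v : `|bc_comp phiC v| <= `|v|.
Proof. by apply: bcnorm_ler => // s; exact: (ler_bcnorm v (phi s)). Qed.

Lemma dirac_subproof (T : topologicalType) (t : T) :
  (fun v : bcfun R T => v t : R^o) \in @cont_linear R (bcfun R T).
Proof.
by apply/cont_linearP; split => //; exists 1 => v; rewrite mul1r ler_bcnorm.
Qed.

Definition bc_dirac (T : topologicalType) (t : T) : tdual (bcfun R T) :=
  Dual (dirac_subproof t).

Lemma pair_left_continuous : continuous (fun x : X => (x, y0)).
Proof. by move=> x; apply: cvg_pair; [exact: cvg_id|exact: cvg_cst]. Qed.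

Lemma pair_right_continuous : continuous (fun y : Y => (x0, y)).
Proof. by move=> y; apply: cvg_pair; [exact: cvg_cst|exact: cvg_id]. Qed.

Let lL := bc_comp_linear pair_left_continuous.
Let lN := bc_comp_norm pair_left_continuous.
Let rL := bc_comp_linear pair_right_continuous.
Let rN := bc_comp_norm pair_right_continuous.

(** [left_lift alpha] is the product of [alpha] with the point mass at [y0], and
    [right_lift beta] that of the point mass at [x0] with [beta]. *)
Definition left_lift : tdual (bcfun R X) -> tdual Cb := adjoint lL lN.
Definition right_lift : tdual (bcfun R Y) -> tdual Cb := adjoint rL rN.

Lemma left_liftE alpha h g :
  left_lift alpha (oplus h g) = alpha h + g y0 * alpha (bc_one R X).
Proof.
rewrite -dualZ -dualD -[LHS]/(alpha (bc_comp pair_left_continuous (oplus h g))).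
congr (alpha _); apply: val_inj; apply/funext => x.
by rewrite -[RHS]/(h x + g y0 * 1) mulr1.
Qed.

Lemma right_liftE beta h g :
  right_lift beta (oplus h g) = beta g + h x0 * beta (bc_one R Y).
Proof.
rewrite -dualZ -dualD -[LHS]/(beta (bc_comp pair_right_continuous (oplus h g))).
congr (beta _); apply: val_inj; apply/funext => y.
by rewrite -[RHS]/(g y + h x0 * 1) mulr1 addrC.
Qed.

Lemma oplus_one : oplus (bc_one R X) 0 = bc_one R (X * Y)%type.
Proof. by apply: val_inj; apply/funext => p; rewrite /= addr0. Qed.

Lemma one_oplus : oplus 0 (bc_one R Y) = bc_one R (X * Y)%type.
Proof. by apply: val_inj; apply/funext => p; rewrite /= add0r. Qed.

Lemma oplus_split (h : bcfun R X) (g : bcfun R Y) :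
  oplus h g = oplus h 0 + oplus 0 g.
Proof.
apply: val_inj; apply/funext => p.
by rewrite -[RHS]/(h p.1 + 0 + (0 + g p.2)) addr0 add0r.
Qed.

Context (mu : probability (borel x0) R) (nu : probability (borel y0) R).
Local Notation m := (integral_dual mu).
Local Notation n := (integral_dual nu).

Lemma marginal1_Hot (eta : tdual Cb) : annihilator (Hot mu nu) eta ->
  marginal1 eta = eta (bc_one R _) *: m.
Proof.
move=> etaH; apply: val_inj; apply/funext => u.
rewrite -[LHS]/(eta (oplus u 0)) -[RHS]/(eta (bc_one R _) * m u).
have := etaH (oplus (- m u *: bc_one R X + u) (- m u *: 0 + 0)).
rewrite oplus_linear oplus_one dualD dualZ => eta0.
have : - m u * eta (bc_one R _) + eta (oplus u 0) = 0; last by lra.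
apply: eta0; exists (- m u *: bc_one R X + u), 0; split.
- by rewrite dualD dualZ (integral_dual_states mu).2; lra.
- exact: dual0.
- by rewrite -oplus_one -oplus_linear scaler0 addr0.
Qed.

Lemma marginal2_Hot (eta : tdual Cb) : annihilator (Hot mu nu) eta ->
  marginal2 eta = eta (bc_one R _) *: n.
Proof.
move=> etaH; apply: val_inj; apply/funext => u.
rewrite -[LHS]/(eta (oplus 0 u)) -[RHS]/(eta (bc_one R _) * n u).
have := etaH (oplus (- n u *: 0 + 0) (- n u *: bc_one R Y + u)).
rewrite oplus_linear one_oplus dualD dualZ => eta0.
have : - n u * eta (bc_one R _) + eta (oplus 0 u) = 0; last by lra.
apply: eta0; exists 0, (- n u *: bc_one R Y + u); split.
- exact: dual0.
- by rewrite dualD dualZ (integral_dual_states nu).2; lra.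
- by rewrite -one_oplus -oplus_linear scaler0 addr0.
Qed.

(** A functional differs from the combination of lifts of its marginals that
    has the same marginals by an annihilator of [Hot]; an element [z] of the
    bidual that vanishes on these annihilators is therefore determined by its
    values on the lifts, that is, by an element of the bidual of each factor. *)
Lemma bidual_HotP (z : tdual (tdual Cb)) : bidual_Hot mu nu z <->
  exists (h : tdual (tdual (bcfun R X))) (g : tdual (tdual (bcfun R Y))),
    [/\ h m = 0, g n = 0 & z = bioplus h g].
Proof.
split=> [zH|[h [g [hm gn ->]]] eta etaH]; last first.
  rewrite -[LHS]/(h (marginal1 eta) + g (marginal2 eta)).
  by rewrite marginal1_Hot// marginal2_Hot// !dualZ hm gn !mulr0 addr0.
have m1 := (integral_dual_states mu).2; have n1 := (integral_dual_states nu).2.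
pose delta : tdual Cb := bc_dirac (x0, y0).
pose c := z (left_lift m); pose d := z (right_lift n).
have cd : z delta = c + d.
  have couplingH : annihilator (Hot mu nu) (left_lift m + right_lift n - delta).
    move=> _ [h [g [mh ng ->]]].
    rewrite -[LHS]/(left_lift m (oplus h g) + right_lift n (oplus h g)
                    - (h x0 + g y0)).
    by rewrite left_liftE right_liftE mh ng m1 n1; lra.
  by have := zH _ couplingH; rewrite dualB dualD -/c -/d; lra.
pose h := adjoint (adjoint_linear lL lN) (adjoint_norm lL lN) z
          - c *: bidual_emb (bc_one R X).
pose g := adjoint (adjoint_linear rL rN) (adjoint_norm rL rN) z
          - d *: bidual_emb (bc_one R Y).
have hE alpha : h alpha = z (left_lift alpha) - c * alpha (bc_one R X) by [].
have gE beta : g beta = z (right_lift beta) - d * beta (bc_one R Y) by [].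
exists h, g; split.
- by rewrite hE m1 mulr1 subrr.
- by rewrite gE n1 mulr1 subrr.
apply: val_inj; apply/funext => eta.
rewrite -[RHS]/(h (marginal1 eta) + g (marginal2 eta)) hE gE.
rewrite -[marginal1 eta (bc_one R X)]/(eta (oplus _ 0)) oplus_one.
rewrite -[marginal2 eta (bc_one R Y)]/(eta (oplus 0 _)) one_oplus.
have := zH (eta - (left_lift (marginal1 eta) + right_lift (marginal2 eta)
                   - eta (bc_one R _) *: delta)).
rewrite !dualB dualD dualZ cd => zeta.
suff /zeta : annihilator (Hot mu nu)
    (eta - (left_lift (marginal1 eta) + right_lift (marginal2 eta)
            - eta (bc_one R _) *: delta)) by lra.
move=> _ [u [v [_ _ ->]]].
rewrite -[LHS]/(eta (oplus u v) - (left_lift (marginal1 eta) (oplus u v)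
  + right_lift (marginal2 eta) (oplus u v) - eta (bc_one R _) * (u x0 + v y0))).
rewrite left_liftE right_liftE oplus_split dualD.
rewrite -[marginal1 eta (bc_one R X)]/(eta (oplus _ 0)) oplus_one.
rewrite -[marginal2 eta (bc_one R Y)]/(eta (oplus 0 _)) one_oplus.
rewrite -[marginal1 eta u]/(eta (oplus u 0)).
rewrite -[marginal2 eta v]/(eta (oplus 0 v)); lra.
Qed.

End BidualOfMarginals.

(** * The constrained superhedging duality *)

Section Superhedging.
Context (R : realType) (X Y : topologicalType) (x0 : X) (y0 : Y).
Context (mu : probability (borel x0) R) (nu : probability (borel y0) R).
Local Notation Cb := (bcfun R (X * Y)%type).
Local Notation one := (bc_one R (X * Y)%type).
Context (N : nat) (f : 'I_N -> Cb).
Local Notation H k := (Hk mu nu f k).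
Local Notation span :=
  (\big[@setadd R _/[set 0]]_(i < N) line (bidual_emb (f i))).

Lemma bidual_Hk_sub (k : nat) (z : tdual (tdual Cb)) : (k <= N)%N ->
  annihilator (annihilator (H k)) z ->
  exists b : 'I_N -> R, bidual_Hot mu nu
    (z - \sum_(i < N | (i < k)%N) b i *: bidual_emb (f i)).
Proof.
elim: k z => [|k IHk] z kN zH.
  by exists (fun=> 0); rewrite big_pred0_eq subr0 /bidual_Hot -(Hk0 mu nu f).
pose i := Ordinal kN; have H0 : H i 0.
  exists 0, (fun=> 0); split; first exact: (Hot_lsubspace mu nu).1.
  by rewrite big1 ?addr0// => j _; rewrite scale0r.
have [|t zt] := @annihilator_ker R _ (annihilator (H i)) (bidual_emb (f i)) z
    (annihilator_lsubspace _).
  move=> eta etaH etaf; apply: zH; rewrite -[k.+1]/(val i).+1 HkS.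
  exact/annihilator_setadd_line.
have [b bH] := IHk _ (ltnW kN) zt; exists (fun j => if j == i then t else b j).
rewrite (sum_ltnS_update i b t (fun j c => c *: bidual_emb (f j))).
by rewrite opprD addrA addrAC.
Qed.

Theorem bidual_HcotE : bidual_Hcot mu nu f = setadd (bidual_Hot mu nu) span.
Proof.
rewrite big_setadd_line; apply/seteqP; split=> [z /bidual_Hk_sub|].
  move=> /(_ (leqnn N))[b]; rewrite (eq_bigl xpredT) => [bH|i]; last first.
    exact: ltn_ord.
  exists (z - \sum_(i < N) b i *: bidual_emb (f i)) => //.
  by exists (\sum_(i < N) b i *: bidual_emb (f i)); [exists b|rewrite subrK].
move=> _ [w Hw [_ [b _ <-] <-]] eta etaH.
have etaf i : eta (f i) = 0.
  apply: etaH; exists 0, (fun j => if j == i then 1 else 0); split.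
    exact: (Hot_lsubspace mu nu).1.
  rewrite add0r (bigD1 i) ?ltn_ord//= eqxx scale1r big1 ?addr0//.
  by move=> j /andP[_ /negbTE ->]; rewrite scale0r.
have etaHot : annihilator (Hot mu nu) eta.
  move=> v Hv; apply: etaH; exists v, (fun=> 0); split=> //.
  by rewrite big1 ?addr0// => j _; rewrite scale0r.
rewrite -[LHS]/(w eta + (\sum_(i < N) b i *: bidual_emb (f i)) eta) Hw// add0r.
apply: (big_ind (fun z : tdual (tdual Cb) => z eta = 0)) => //.
  by move=> z z' z0 z'0; rewrite -[LHS]/(z eta + z' eta) z0 z'0 addr0.
by move=> i _; rewrite -[LHS]/(b i * eta (f i)) etaf mulr0.
Qed.

Context (Hf : forall k : 'I_N,
  (ereal_inf [set (eta (f k))%:E | eta in Qk mu nu f k] < 0%:E)%E /\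
  (0%:E < ereal_sup [set (eta (f k))%:E | eta in Qk mu nu f k])%E).

Theorem KcotE : Kcot mu nu f = setadd (bidual_Hcot mu nu f) (@bidual_neg R _).
Proof.
apply/seteqP; split=> [z Kz|]; last first.
  move=> _ [w Hw [z z0 <-]] eta /QkP[_ etaP etaH].
  rewrite -[leLHS]/(w eta + z eta) Hw// add0r -oppr_ge0.
  exact: (z0 eta etaP).
have [HS [C C0 domH]] := Hk_bounded_domination Hf (leqnn N).
have [|W HW zW] := bidual_domination (@bc_pos_cone R _) HS (z := z) C0 domH.
  move=> eta etaP etaH.
  have [->|[e eS [t t0 eta_e]]] := dual_pos_ge0_states etaP.
    by rewrite dual0.
  have [tz|tn0] := eqVneq t 0; first by rewrite eta_e tz scale0r dual0.
  rewrite eta_e dualZ; apply: mulr_ge0_le0 => //; apply: Kz; split=> // v Hv.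
  have := etaH _ Hv; rewrite eta_e -[(t *: e) v]/(t * e v) => /eqP.
  by rewrite mulf_eq0 (negbTE tn0) => /eqP.
exists W => //; exists (z - W); last by rewrite addrC subrK.
move=> eta etaP; rewrite opprB -[leRHS]/(W eta - z eta) subr_ge0.
exact: zW.
Qed.

(** Since states take the value [1] at the constant [1], membership of
    [a - c *: bidual_emb one] in [Kcot] reads [a <= c] on [Qcot]. *)
Lemma hedgeP (a : tdual (tdual Cb)) (c : R) :
  (exists2 z, setadd (bidual_Hcot mu nu f) (@bidual_neg R _) z &
     c *: bidual_emb one + z = a) <->
  (forall eta, Qcot mu nu f eta -> a eta <= c).
Proof.
rewrite -KcotE; split=> [[z Kz <-] eta Qeta|ac].
  have [[_ e1] _ _] := QkP Qeta.
  rewrite -[leLHS]/(c * eta one + z eta) e1 mulr1.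
  by have := Kz _ Qeta; lra.
exists (a - c *: bidual_emb one); last by rewrite addrC subrK.
move=> eta Qeta; have [[_ e1] _ _] := QkP Qeta.
rewrite -[leLHS]/(a eta - c * eta one) e1 mulr1.
by have := ac _ Qeta; lra.
Qed.

Lemma bidual_hedgeP (a : tdual (tdual Cb)) (c : R) :
  (exists (h : tdual (tdual (bcfun R X))) (g : tdual (tdual (bcfun R Y)))
     (b : 'I_N -> R),
     [/\ h (integral_dual mu) = 0, g (integral_dual nu) = 0
       & bidual_le a (c *: bidual_emb one + bioplus h g +
                      \sum_(k < N) b k *: bidual_emb (f k))]) <->
  (forall eta, Qcot mu nu f eta -> a eta <= c).
Proof.
rewrite -hedgeP bidual_HcotE big_setadd_line; split.
  move=> [h [g [b [hm gn ac]]]].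
  pose w := bioplus h g + \sum_(k < N) b k *: bidual_emb (f k).
  exists (a - c *: bidual_emb one); last by rewrite addrC subrK.
  exists w.
    exists (bioplus h g); first by apply/bidual_HotP; exists h, g.
    by exists (\sum_(k < N) b k *: bidual_emb (f k)) => //; exists b.
  exists (a - c *: bidual_emb one - w); last by rewrite addrC subrK.
  rewrite -[bidual_neg _]/(bidual_pos (- (a - c *: bidual_emb one - w))).
  by rewrite opprB opprB addrA (addrC w) /w addrA.
move=> [_ [_ [w /bidual_HotP[h [g [hm gn ->]]] [_ [b _ <-] <-]] [z z0 <-]] <-].
exists h, g, b; split=> //; rewrite /bidual_le.
set s := \sum_(k < N) _; rewrite addrA (addrA (_ *: _)) opprD addrA subrr add0r.
exact: z0.
Qed.

Theorem constrained_duality (a : tdual (tdual Cb)) :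
  ereal_sup [set (a eta)%:E | eta in Qcot mu nu f] =
    Dval a (setadd (bidual_Hcot mu nu f) (@bidual_neg R _)) /\
  let feasible := [set c : R |
    exists (h : tdual (tdual (bcfun R X))) (g : tdual (tdual (bcfun R Y)))
           (b : 'I_N -> R),
      [/\ h (integral_dual mu) = 0, g (integral_dual nu) = 0
        & bidual_le a (c *: bidual_emb one + bioplus h g +
                       \sum_(k < N) b k *: bidual_emb (f k))]] in
  exists c : R,
    [/\ feasible c, lbound feasible c
      & Dval a (setadd (bidual_Hcot mu nu f) (@bidual_neg R _)) = c%:E].
Proof.
have [eta0 Qeta0] := Qcot_nonempty Hf.
pose A : set R := [set (a eta : R) | eta in Qcot mu nu f].
have A0 : A !=set0 by exists (a eta0), eta0.
have ubA : has_ubound A.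
  exists `|a| => _ [eta /QkP[/states_norm e1 _ _] <-].
  rewrite (le_trans (ler_norm _))// (le_trans (ler_dual_norm _ _))//.
  by rewrite ler_piMr.
have supP c : (forall eta, Qcot mu nu f eta -> a eta <= c) <-> sup A <= c.
  split=> [ac|Ac eta Qeta].
    by apply: ge_sup => // _ [eta Qeta <-]; exact: ac.
  by apply: le_trans Ac; apply: ub_le_sup => //; exists eta.
have DE : Dval a (setadd (bidual_Hcot mu nu f) (@bidual_neg R _)) = (sup A)%:E.
  apply/eqP; rewrite eq_le; apply/andP; split.
    by apply: ereal_inf_lbound; exists (sup A) => //; apply/hedgeP/supP.
  by apply: le_ereal_inf_tmp => _ [c /hedgeP/supP Ac <-]; rewrite lee_fin.
split; last first.
  exists (sup A); split=> //; first exact/bidual_hedgeP/supP.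
  by move=> c /bidual_hedgeP/supP.
rewrite DE -ereal_sup_EFin//; congr ereal_sup.
by rewrite /A -image_comp.
Qed.

End Superhedging.

Theorem proposition6p3 (R : realType) (d : nat) (X Y : set 'rV[R]_d)
    (cX : closed X) (cY : closed Y) (x0 : set_type X) (y0 : set_type Y)
    (mu : probability (borel x0) R) (nu : probability (borel y0) R)
    (N : nat) (f : 'I_N -> bcfun R (set_type X * set_type Y)%type)
    (Hf : forall k : 'I_N,
      (ereal_inf [set (eta (f k))%:E | eta in Qk mu nu f k] < 0%:E)%E /\
      (0%:E < ereal_sup [set (eta (f k))%:E | eta in Qk mu nu f k])%E) :
  [/\ bidual_Hcot mu nu f =
        setadd (bidual_Hot mu nu)
          (\big[@setadd R _/[set 0]]_(i < N) line (bidual_emb (f i))),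
      Kcot mu nu f = setadd (bidual_Hcot mu nu f) (@bidual_neg R _)
    & forall a : tdual (tdual (bcfun R (set_type X * set_type Y)%type)),
        ereal_sup [set (a eta)%:E | eta in Qcot mu nu f] =
          Dval a (setadd (bidual_Hcot mu nu f) (@bidual_neg R _)) /\
        let feasible := [set c : R |
          exists (h : tdual (tdual (bcfun R (set_type X))))
                 (g : tdual (tdual (bcfun R (set_type Y))))
                 (b : 'I_N -> R),
            [/\ h (integral_dual mu) = 0, g (integral_dual nu) = 0
              & bidual_le a (c *: bidual_emb (bc_one R _) + bioplus h g +
                             \sum_(k < N) b k *: bidual_emb (f k))]] in
        exists c : R,
          [/\ feasible c, lbound feasible c
            & Dval a (setadd (bidual_Hcot mu nu f) (@bidual_neg R _)) = c%:E]].
Proof.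
split; [exact: bidual_HcotE|exact: KcotE|exact: constrained_duality].
Qed.
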